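(* Let $\beta\in(0,1)$ and let $D=\nabla\psi:\mathbb{R}^{d_0}\to\mathbb{R}^{d_0}$ be $\beta^{-1}$-Lipschitz continuous for some Fréchet differentiable convex function $\psi\in\Gamma_0(\mathbb{R}^{d_0})$ (i.e., $D$ is a MoL-Grad denoiser), and let $\varphi:=\psi^*-\tfrac12\|\cdot\|^2$. Let $\mathcal{M}\subset\mathbb{R}^{d_0}$ be a subspace and $\mu>0$, and let $\Phi\in\Gamma_0(\mathbb{R}^{d_0})$ be a smooth function which is $(1/\mu)$-strongly convex over $\mathcal{M}$, in the sense that $$h:\boldsymbol{v}\mapsto\mu\Phi(\boldsymbol{v})-\tfrac12\|P_{\mathcal{M}}\boldsymbol{v}\|^2$$ belongs to $\Gamma_0(\mathbb{R}^{d_0})$, and suppose $h$ is $\kappa$-smooth for some $\kappa>0$. Let the step sizes $\sigma,\tau>0$ satisfy (i) $\sigma\le\dfrac{\beta}{1-\beta}$, and (ii) $\tau\left(\sigma+\dfrac{\kappa}{2}\right)<1$. For arbitrary $(\boldsymbol{v}_0,\boldsymbol{u}_0)\in\mathbb{R}^{d_0}\times\mathbb{R}^{d_0}$, let $(\boldsymbol{v}_k)_{k\in\mathbb{N}}$ and $(\boldsymbol{u}_k)_{k\in\mathbb{N}}$ be generated, for $k=0,1,2,\dots$, by $$\begin{aligned} \tilde{\boldsymbol{u}}_{k+1}&:=\boldsymbol{u}_k+\sigma\boldsymbol{v}_k,\\ \boldsymbol{u}_{k+1}&:=\tilde{\boldsymbol{u}}_{k+1}-\sigma D\big(\tilde{\boldsymbol{u}}_{k+1}/(\sigma+1)\big),\\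 \tilde{\boldsymbol{v}}_{k+1}&:=\tau\nabla\big(\mu\Phi+\tfrac12\|P_{\mathcal{M}^\perp}\cdot\|^2\big)(\boldsymbol{v}_k),\\ \boldsymbol{v}_{k+1}&:=(1+\tau)\boldsymbol{v}_k-\tilde{\boldsymbol{v}}_{k+1}-\tau(2\boldsymbol{u}_{k+1}-\boldsymbol{u}_k). \end{aligned}$$ Then $(\boldsymbol{v}_k)_{k\in\mathbb{N}}$ and $(\boldsymbol{u}_k)_{k\in\mathbb{N}}$ converge, respectively, to solutions $\check{\boldsymbol{v}}\in\mathbb{R}^{d_0}$ and $\check{\boldsymbol{u}}\in\mathbb{R}^{d_0}$ of the primal and dual problems $$\min_{\boldsymbol{v}\in\mathbb{R}^{d_0}}\ \mu\Phi(\boldsymbol{v})+(\sigma+1)\varphi(\boldsymbol{v})+\tfrac12\|P_{\mathcal{M}^\perp}\boldsymbol{v}\|^2,$$ $$\min_{\boldsymbol{u}\in\mathbb{R}^{d_0}}\ h^*(-\boldsymbol{u})+\Big[(\sigma+1)\varphi+\tfrac12\|\cdot\|^2\Big]^*(\boldsymbol{u}),$$ provided that such solutions exist.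
   Context: $\Gamma_0(\mathbb{R}^{d_0})$ is the set of proper lower semicontinuous convex functions from $\mathbb{R}^{d_0}$ to $\mathbb{R}\cup\{+\infty\}$. $f^*(\boldsymbol{z}):=\sup_{\boldsymbol{x}}(\langle\boldsymbol{x},\boldsymbol{z}\rangle-f(\boldsymbol{x}))$ is the Fenchel conjugate of $f$. $\|\cdot\|$ is the Euclidean norm. $P_{\mathcal{M}}$ and $P_{\mathcal{M}^\perp}$ are the orthogonal projections onto $\mathcal{M}$ and its orthogonal complement $\mathcal{M}^\perp$. A function is smooth if it is differentiable on $\mathbb{R}^{d_0}$ with Lipschitz continuous gradient, and $\kappa$-smooth if its gradient is $\kappa$-Lipschitz continuous. A known fact (which may be used): for every $\beta\in(0,1)$, an operator $D$ is $\beta^{-1}$-Lipschitz and of the form $D=\nabla\psi$ with $\psi$ Fréchet differentiable and convex if and only if $D=\text{s-Prox}_\varphi$ for some $\varphi:\mathbb{R}^{d_0}\to(-\infty,\infty]$ with $\varphi+[(1-\beta)/2]\|\cdot\|^2\in\Gamma_0(\mathbb{R}^{d_0})$, and then $\varphi=\psi^*-\tfrac12\|\cdot\|^2$. Here $\text{s-Prox}_\varphi(\boldsymbol{x})$ denotes the unique minimizer of $\boldsymbol{y}\mapsto\varphi(\boldsymbol{y})+\tfrac12\|\boldsymbol{x}-\boldsymbol{y}\|^2$ (assumed to exist for every $\boldsymbol{x}$). *)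

(* Defs.v *)
From HB Require Import structures.
From mathcomp Require Import all_boot all_order all_algebra.
From mathcomp Require Import sesquilinear.
From mathcomp Require Import all_classical all_reals all_analysis.

Set Implicit Arguments.
Unset Strict Implicit.
Unset Printing Implicit Defensive.
Import Order.TTheory GRing.Theory Num.Theory.
Import numFieldNormedType.Exports.
Local Open Scope ring_scope.
Local Open Scope classical_set_scope.

(* R^d is 'rV[R]_d.  The norm that the library puts on 'rV[R]_d is the sup
   norm; it induces the Euclidean topology and the same Fréchet differentials,
   so the library's convergence, lower semicontinuity and differentiability are
   used as they are.  Lipschitz constants depend on the norm, hence `enorm` and
   `elipschitz`. *)
Section Euclidean.
Context {R : realType} {d : nat}.
Implicit Types (u v w : 'rV[R]_d) (M : {vspace 'rV[R]_d}).

Definition dot u v : R := \sum_(i < d) u 0 i * v 0 i.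

Definition enorm u : R := Num.sqrt (dot u u).

Definition elipschitz (L : R) (F : 'rV[R]_d -> 'rV[R]_d) :=
  forall u v, enorm (F u - F v) <= L * enorm (u - v).

Lemma dotC u v : dot u v = dot v u.
Proof. by apply: eq_bigr => i _; rewrite mulrC. Qed.

Lemma dot_linearr u : linear_for *%R (dot u).
Proof.
move=> a v w; rewrite /dot mulr_sumr -big_split /=; apply: eq_bigr => i _.
by rewrite !mxE mulrDr mulrCA.
Qed.

Fact dot_is_bilinear : bilinear_for
  (GRing.Scale.Law.clone _ _ *%R _) (GRing.Scale.Law.clone _ _ (idfun \; *%R) _) dot.
Proof.
split=> [v|u]; last exact: dot_linearr.
by move=> a x y /=; rewrite ![dot _ v]dotC; apply: dot_linearr.
Qed.

HB.instance Definition _ :=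
  bilinear_isBilinear.Build R _ _ _ _ _ dot dot_is_bilinear.

Fact dot_is_hermitian u v : dot u v = (-1) ^+ false * idfun (dot v u).
Proof. by rewrite expr0 mul1r dotC. Qed.

HB.instance Definition _ :=
  @isHermitianSesquilinear.Build _ _ _ _ dot dot_is_hermitian.

Lemma dot_eq0 u : dot u u = 0 -> u = 0.
Proof.
move=> /eqP; rewrite psumr_eq0; last by move=> i _; rewrite -expr2 sqr_ge0.
move=> /allP u0; apply/rowP => i; rewrite mxE; apply/eqP.
by have := u0 i (mem_index_enum i); rewrite /= mulf_eq0 orbb.
Qed.

Definition ocompl M : {vspace 'rV[R]_d} := orthov dot M.

Definition oproj M v : 'rV[R]_d := daddv_pi M (ocompl M) v.

Lemma capv_ocompl M : (M :&: ocompl M = 0)%VS.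
Proof.
apply/eqP; rewrite -subv0; apply/subvP => u.
rewrite memv_cap memv0 => /andP[uM /mem_orthovP uu].
by apply/eqP/dot_eq0/uu.
Qed.

Lemma addv_ocompl M : (M + ocompl M = fullv)%VS.
Proof.
apply/eqP; rewrite eqEdim subvf /= (dimv_disjoint_sum (capv_ocompl M)).
pose f (v : 'rV[R]_d) : 'rV[R]_(\dim M) := \row_i dot v (vbasis M)`_i.
have lf : linear f.
  move=> a v w; apply/rowP => i; rewrite !mxE.
  by rewrite ![dot _ (vbasis M)`_i]dotC dot_linearr.
pose F : {linear 'rV[R]_d -> 'rV[R]_(\dim M)} :=
  HB.pack f (GRing.isLinear.Build _ _ _ _ f lf).
have <- : (lker (linfun F) = ocompl M)%VS.
  apply/vspaceP => v; rewrite memv_ker lfunE /=.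
  apply/eqP/mem_orthovP => [fv0 w wM|vM].
    rewrite (coord_vbasis wM) linear_sumr /= big1 // => i _.
    rewrite linearZr /=.
    by have /rowP/(_ i) := fv0; rewrite !mxE => ->; rewrite mulr0.
  apply/rowP => i; rewrite !mxE; apply: vM.
  by rewrite vbasis_mem ?mem_nth ?size_tuple.
rewrite -(limg_ker_dim (linfun F) fullv) capfv addnC leq_add2r.
apply: leq_trans (dimvS (subvf _)) _.
by rewrite dimvf /dim /= mul1n.
Qed.

Lemma oproj_in M v : oproj M v \in M.
Proof. exact: memv_pi. Qed.

Lemma oproj_orth M v w : w \in M -> dot (v - oproj M v) w = 0.
Proof.
move=> wM; have : v - oproj M v \in ocompl M; last by move/mem_orthovP; apply.
have <- : daddv_pi (ocompl M) M v = v - oproj M v; last exact: memv_pi.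
have vMM : v \in (M + ocompl M)%VS by rewrite addv_ocompl memvf.
apply/eqP; rewrite eq_sym subr_eq addrC.
by rewrite (daddv_pi_add (capv_ocompl M) vMM).
Qed.

End Euclidean.

Section Gradient.
Context {R : realType} {d : nat}.
Implicit Types (f : 'rV[R]_d -> R) (x v : 'rV[R]_d).

Definition grad f x : 'rV[R]_d := \row_i ('d f x (delta_mx 0 i)).

Lemma gradE f x v : differentiable f x -> 'd f x v = dot (grad f x) v.
Proof.
move=> df; rewrite {1}(row_sum_delta v) linear_sum; apply: eq_bigr => i _.
by rewrite linearZ /= mxE mulrC.
Qed.

Definition ksmooth (L : R) f :=
  (forall x, differentiable f x) /\ elipschitz L (grad f).

Definition smooth f := exists L, ksmooth L f.

End Gradient.

Section ConvexAnalysis.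
Context {R : realType} {d : nat}.
Implicit Types f : 'rV[R]_d -> \bar R.
Local Open Scope ereal_scope.

Definition eproper f := (forall x, f x != -oo) /\ (exists x, f x < +oo).

Definition econvex f := forall x y (t : R), (0 < t < 1)%R ->
  f (t *: x + (1 - t) *: y)%R <= t%:E * f x + (1 - t)%:E * f y.

(* Values are in (-oo, +oo] for proper f, so the right-hand side of `econvex`
   and the difference in `conjugate` are never indeterminate. *)
Definition Gamma0 f := [/\ eproper f, econvex f & lower_semicontinuous f].

Definition conjugate f (z : 'rV[R]_d) : \bar R :=
  ereal_sup [set (dot x z)%:E - f x | x in [set: 'rV[R]_d]].

Definition minimizer f x := forall y, f x <= f y.

End ConvexAnalysis.

(* Main.v *)
(* Put g := (sigma + 1) phi + |.|^2 / 2 = (sigma + 1) psi^* - sigma / 2 |.|^2.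
   Since |w|^2 = |P_M w|^2 + |P_M^perp w|^2, the primal objective is h + g and the
   iteration is the Condat-Vu primal-dual method for h + g.  Only D enters the
   convergence proof: w = D ((u + sigma w) / (sigma + 1)) stands for u in dg(w),
   and monotonicity of this relation is the cocoercivity of D (Baillon-Haddad)
   combined with (i).  With cocoercivity of grad h and (ii), the iterates are
   Fejer monotone for the quadratic form |a|^2 / tau + 2 <a, b> + |b|^2 / sigma
   with summable steps, hence converge to a fixed point.  Fixed points are the
   Karush-Kuhn-Tucker pairs, so they solve both problems; conversely a primal
   minimizer v yields the fixed point (v, - grad h v), whose existence is all
   the Fejer argument needs. *)

Require Import Defs.
From mathcomp Require Import all_boot all_order all_algebra.
From mathcomp Require Import ring lra.
From mathcomp Require Import all_classical all_reals all_analysis.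

Set Implicit Arguments.
Unset Strict Implicit.
Unset Printing Implicit Defensive.
Import Order.TTheory GRing.Theory Num.Theory.
Import numFieldNormedType.Exports.
Local Open Scope ring_scope.
Local Open Scope classical_set_scope.

(** * Euclidean geometry of [dot], compared with the sup norm of row vectors *)

Section EuclideanTheory.
Context {R : realType} {d : nat}.
Implicit Types u v w : 'rV[R]_d.

Lemma dotDr u v w : dot u (v + w) = dot u v + dot u w.
Proof. by rewrite -[v]scale1r dot_linearr mul1r scale1r. Qed.

Lemma dotDl u v w : dot (u + v) w = dot u w + dot v w.
Proof. by rewrite dotC dotDr !(dotC w). Qed.

Lemma dotZr a u v : dot u (a *: v) = a * dot u v.
Proof. by rewrite /dot mulr_sumr; apply: eq_bigr => i _; rewrite mxE mulrCA. Qed.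

Lemma dotZl a u v : dot (a *: u) v = a * dot u v.
Proof. by rewrite dotC dotZr dotC. Qed.

Lemma dotNr u v : dot u (- v) = - dot u v.
Proof. by rewrite -scaleN1r dotZr mulN1r. Qed.

Lemma dotNl u v : dot (- u) v = - dot u v.
Proof. by rewrite dotC dotNr dotC. Qed.

Definition dotE := (dotDl, dotDr, dotNl, dotNr, dotZl, dotZr).

Lemma dot_ge0 u : 0 <= dot u u.
Proof. by apply: sumr_ge0 => i _; rewrite -expr2 sqr_ge0. Qed.

Lemma enorm_sqr u : enorm u ^+ 2 = dot u u.
Proof. by rewrite sqr_sqrtr ?dot_ge0. Qed.

Lemma elipschitz_sqr (L : R) F u v : 0 <= L -> elipschitz L F ->
  dot (F u - F v) (F u - F v) <= L ^+ 2 * dot (u - v) (u - v).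
Proof.
move=> L0 /(_ u v) FL; rewrite -!enorm_sqr -exprMn ler_sqr ?nnegrE //.
  exact: sqrtr_ge0.
by rewrite mulr_ge0 // sqrtr_ge0.
Qed.

Lemma dotD_le u v : dot (u + v) (u + v) <= 2 * dot u u + 2 * dot v v.
Proof.
have := dot_ge0 (u - v); rewrite !dotE (dotC v u); lra.
Qed.

Lemma coord_sqr_le u i : u 0 i ^+ 2 <= dot u u.
Proof.
rewrite /dot (bigD1 i) //= -expr2 lerDl.
by apply: sumr_ge0 => j _; rewrite -expr2 sqr_ge0.
Qed.

(** With [dot_le_norm_sqr], lets estimates in [dot] decide convergence and clustering in the
    sup-norm topology. *)
Lemma norm_sqr_le_dot u : `|u| ^+ 2 <= dot u u.
Proof.
have [->|u0] := eqVneq u 0; first by rewrite normr0 expr0n /= dot_ge0.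
rewrite -enorm_sqr ler_sqr ?nnegrE ?sqrtr_ge0 //.
rewrite /Num.norm /= mx_normrE; apply: bigmax_le => [|[i j] _] /=.
  exact: sqrtr_ge0.
rewrite -(ler_sqr (normr_ge0 _)) ?nnegrE ?sqrtr_ge0 //.
by rewrite enorm_sqr real_normK ?num_real// ord1 coord_sqr_le.
Qed.

Lemma dot_le_norm_sqr u : dot u u <= d%:R * `|u| ^+ 2.
Proof.
rewrite /dot mulr_natl -[X in _ *+ X]card_ord -sumr_const; apply: ler_sum => i _.
rewrite -expr2 -[leLHS]real_normK ?num_real// ler_sqr ?nnegrE //.
by rewrite [leRHS]/Num.norm /= mx_normrE; apply: (le_bigmax _ _ (0, i)).
Qed.

Lemma cvg_dot_sub (z : nat -> 'rV[R]_d) p :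
  (fun k => dot (z k - p) (z k - p)) @ \oo --> 0 -> z @ \oo --> p.
Proof.
move=> zp; apply/cvgrPdist_lt => e e0.
have e2 : 0 < e ^+ 2 by rewrite exprn_gt0.
move/cvgrPdist_lt/(_ _ e2): zp; apply: filterS => k.
rewrite sub0r normrN ger0_norm ?dot_ge0 // => zk.
rewrite distrC -ltr_sqr ?nnegrE ?(ltW e0) //.
exact: le_lt_trans (norm_sqr_le_dot _) zk.
Qed.

End EuclideanTheory.

(** The energy to a fixed point decreases along the orbit, so the steps tend to 0 and the orbit is
    bounded. A cluster point is then fixed by continuity of [T], and the energy to it, being
    monotone and arbitrarily small along a subsequence, tends to 0. *)
Lemma fejer_fixpoint_cvg (R : realType) (n : nat) (z : nat -> 'rV[R]_n)
    (T : 'rV[R]_n -> 'rV[R]_n) (L c C : R) (E : 'rV[R]_n -> R) (x0 : 'rV[R]_n) :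
  (forall k, z k.+1 = T (z k)) ->
  (forall x y, dot (T x - T y) (T x - T y) <= L * dot (x - y) (x - y)) ->
  0 < c ->
  (forall x, c * dot x x <= E x) -> (forall x, E x <= C * dot x x) ->
  (forall p x, T p = p ->
     E (T x - p) <= E (x - p) - c * dot (T x - x) (T x - x)) ->
  T x0 = x0 ->
  exists2 p, T p = p & (fun k => dot (z k - p) (z k - p)) @ \oo --> 0.
Proof.
move=> zS TL c0 cE EC Edecr Tx0.
have E0 x : 0 <= E x by apply: le_trans (cE x); rewrite mulr_ge0 ?dot_ge0 ?ltW.
have Emono p : T p = p -> nonincreasing_seq (fun k => E (z k - p)).
  move=> Tp; apply/nonincreasing_seqP => k; rewrite zS.
  apply: le_trans (Edecr _ _ Tp) _.
  by rewrite lerBlDr lerDl mulr_ge0 ?dot_ge0 ?ltW.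
have Ecvg p : T p = p -> cvgn (fun k => E (z k - p)).
  move=> Tp; apply: nonincreasing_is_cvgn; first exact: Emono.
  by exists 0 => _ [k _ <-].
have step0 : (fun k => dot (z k.+1 - z k) (z k.+1 - z k)) @ \oo --> 0.
  have h0 : (fun k => c^-1 * (E (z k - x0) - E (z k.+1 - x0))) @ \oo --> 0.
    have -> : 0 = c^-1 * (limn (fun k => E (z k - x0)) -
                          limn (fun k => E (z k - x0))) by rewrite subrr mulr0.
    apply: cvgMr; apply: cvgB; first exact: Ecvg.
    by have := Ecvg _ Tx0; rewrite -(cvg_shiftS (fun k => E (z k - x0))).
  apply: (squeeze_cvgr _ (cvg_cst 0) h0); near=> k.
  rewrite dot_ge0 /= ler_pdivlMl //.
  have := Edecr _ (z k) Tx0; rewrite -zS; lra.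
(* The energy bounds the squared distance to [x0] by [r - 1], and [y ^+ 2 <= r - 1] implies
   [y <= r]. *)
pose r := 1 + c^-1 * E (z 0%N - x0).
have cB : compact (closed_ball_ Num.norm x0 r).
  apply: bounded_closed_compact; last exact: closed_closed_ball_.
  exists (`|x0| + r); split; first exact: num_real.
  move=> K rK x /= xr; apply: le_trans (ltW rK).
  by rewrite -[x](subKr x0); apply: le_trans (ler_normB _ _) _; rewrite lerD2l.
have [p [_ zp]] : (closed_ball_ Num.norm x0 r `&` cluster (z @ \oo)) !=set0.
  apply: cB; exists 0%N => // k _ /=; rewrite /closed_ball_ /= distrC.
  suff : `|z k - x0| ^+ 2 <= r - 1 by have := normr_ge0 (z k - x0); nra.
  rewrite /r addrAC subrr add0r ler_pdivlMl //.
  apply: le_trans (Emono _ Tx0 0%N k (leq0n k)).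
  by apply: le_trans (cE _); rewrite ler_pM2l // norm_sqr_le_dot.
have zp_close e N : 0 < e -> exists2 k, (N <= k)%N & dot (z k - p) (z k - p) < e.
  move=> e0.
  (* [del <= 1] gives [y ^+ 2 <= del] for [0 <= y < del], and [n%:R * del < e]; the successor also
     covers [n = 0]. *)
  pose del := Num.min 1 (e / n.+1%:R).
  have del0 : 0 < del by rewrite lt_min ltr01 divr_gt0.
  have [] := zp [set z k | k in [set k | (N <= k)%N]] (ball p del).
  - by exists N => // k Nk; exists k.
  - exact: nbhsx_ballx.
  move=> _ [[k Nk <-]]; rewrite -ball_normE /= distrC => zk; exists k => //.
  apply: le_lt_trans (dot_le_norm_sqr _) _.
  have del1 : del <= 1 by rewrite /del ge_min lexx.
  have dele : del * n.+1%:R <= e by rewrite -ler_pdivlMr // /del ge_min lexx orbT.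
  have := normr_ge0 (z k - p); move: dele zk; rewrite -natr1.
  have : 0 <= n%:R :> R by [].
  move: (n%:R : R) `|z k - p| => m y m0 dele yd y0.
  have : y ^+ 2 <= del by nra.
  nra.
have Tp : T p = p.
  apply/eqP; rewrite -subr_eq0; apply/eqP/dot_eq0/le_anti; rewrite dot_ge0 andbT.
  apply/ler_addgt0Pr => e e0; rewrite add0r.
  (* Splitting [T p - p] in three through [T (z k)] and [z k] yields the coefficients [2 * L + 4]
     and [4], of sum at most [K]. *)
  pose K := 2 * `|L| + 8; have K0 : 0 < K by rewrite ltr_wpDl // mulr_ge0.
  have eK : 0 < e / K by rewrite divr_gt0.
  have /cvgrPdist_lt/(_ _ eK)[N _ hN] := step0.
  have [k Nk zk] := zp_close _ N eK.
  have := hN k Nk; rewrite sub0r normrN ger0_norm ?dot_ge0 // => sk.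
  have -> : T p - p = (T p - T (z k)) + ((z k.+1 - z k) + (z k - p)).
    by rewrite zS !addrA !subrK.
  apply: le_trans (dotD_le _ _) _.
  have := dotD_le (z k.+1 - z k) (z k - p); have := TL p (z k).
  have -> : p - z k = - (z k - p) by rewrite opprB.
  rewrite dotNl dotNr opprK.
  have -> : e = K * (e / K) by rewrite mulrCA divff ?mulr1 ?gt_eqF.
  rewrite {1}/K; have := dot_ge0 (z k - p).
  have : L <= `|L| by exact: ler_norm.
  have : 0 <= `|L| by [].
  nra.
exists p => //; apply/cvgrPdist_lt => e e0.
pose K := `|C| + 1; have K0 : 0 < K by rewrite ltr_wpDl.
have eK : 0 < c * e / K by rewrite divr_gt0 // mulr_gt0.
have [k _ zk] := zp_close _ 0%N eK.
exists k => // j /= kj; rewrite sub0r normrN ger0_norm ?dot_ge0 //.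
rewrite -(ltr_pM2l c0); apply: le_lt_trans (cE _) _.
apply: le_lt_trans (Emono _ Tp _ _ kj) _; apply: le_lt_trans (EC _) _.
have := dot_ge0 (z k - p); move: zk; rewrite ltr_pdivlMr // /K.
have := ler_norm C; nra.
Unshelve. all: by end_near.
Qed.

(** * Gradients of smooth convex functions *)

Lemma is_derive_quad (R : realType) (a b t : R) :
  is_derive t 1 (fun s : R => s * a + s ^+ 2 * b) (a + 2 * t * b).
Proof.
have h1 : is_derive t 1 (@id R) 1 by exact: is_derive_id.
have := is_deriveD (is_deriveZ a h1) (is_deriveZ b (is_deriveX 2 h1)).
rewrite (_ : _ + _ = (fun s : R => s * a + s ^+ 2 * b)).
  suff -> : a + 2 * t * b = a *: 1 + b *: ((2 * t ^+ 1) *: 1) by [].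
  by rewrite /GRing.scale /=; ring.
apply/funext => s /=; rewrite !fctE /= /GRing.scale /=; ring.
Qed.

Section GradientTheory.
Context {R : realType} {d : nat}.
Implicit Types (f : 'rV[R]_d -> R) (x y v : 'rV[R]_d).

Lemma is_derive_line f x v (t : R) : differentiable f (x + t *: v) ->
  is_derive t 1 (fun s : R => f (x + s *: v)) (dot (grad f (x + t *: v)) v).
Proof.
move=> df; have quot : (fun h : R => h^-1 *: (f (x + (h *: 1 + t) *: v) -
    f (x + t *: v))) = (fun h : R => h^-1 *: (f (h *: v + (x + t *: v)) -
    f (x + t *: v))).
  apply/funext => h; congr (_ *: (f _ - _)).
  by rewrite [h *: 1]mulr1 scalerDl addrCA.
have dv : derivable f (x + t *: v) v by exact: diff_derivable.
apply: DeriveDef; first by rewrite /derivable /= quot.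
by rewrite /derive /= quot -gradE // -deriveE.
Qed.

Lemma line_quotient_cvg f x v : differentiable f x ->
  (fun t : R => t^-1 * (f (x + t *: v) - f x)) @ 0^'+ --> dot (grad f x) v.
Proof.
move=> df; have [] := @is_derive_line f x v 0 _; first by rewrite scale0r addr0.
rewrite scale0r addr0 => dl; rewrite /derive /= => <-.
apply: cvg_dnbhs_at_right; move: dl; rewrite /derivable scale0r addr0 /=.
suff -> : (fun h : R => h^-1 *: (f (x + (h *: 1 + 0) *: v) - f x)) =
          (fun t : R => t^-1 * (f (x + t *: v) - f x)) by [].
by apply/funext => h; rewrite [h *: 1]mulr1 addr0.
Qed.

Lemma cvg_affine_at_right0 (a b : R) : (fun t : R => a + t * b) @ 0^'+ --> a.
Proof.
rewrite -[X in _ --> X]addr0 -[X in _ --> _ + X](mul0r b).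
apply: cvg_at_right_filter; apply: cvgD; first exact: cvg_cst.
by apply: cvgMl; exact: cvg_id.
Qed.

(** Divide by [t] and let [t] tend to 0 from the right: the quadratic term vanishes. *)
Lemma dot_grad_le f x v (a b : R) : differentiable f x ->
  (forall t : R, 0 < t < 1 -> f (x + t *: v) - f x <= t * a + t ^+ 2 * b) ->
  dot (grad f x) v <= a.
Proof.
move=> df fle.
apply: (ler_cvg_to (line_quotient_cvg df) (@cvg_affine_at_right0 a b)).
near=> t; have t0 : 0 < t by near: t; exact: nbhs_right_gt.
rewrite ler_pdivrMl // mulrDr mulrA -expr2; apply: fle; rewrite t0.
by near: t; exact: nbhs_right_lt.
Unshelve. all: by end_near.
Qed.

Lemma dot_grad_ge f x v (a b : R) : differentiable f x ->
  (forall t : R, 0 < t < 1 -> t * a + t ^+ 2 * b <= f (x + t *: v) - f x) ->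
  a <= dot (grad f x) v.
Proof.
move=> df fge.
apply: (ler_cvg_to (@cvg_affine_at_right0 a b) (line_quotient_cvg df)).
near=> t; have t0 : 0 < t by near: t; exact: nbhs_right_gt.
rewrite ler_pdivlMl // mulrDr mulrA -expr2; apply: fge; rewrite t0.
by near: t; exact: nbhs_right_lt.
Unshelve. all: by end_near.
Qed.

Lemma convex_grad_ge f x y : econvex (EFin \o f) -> differentiable f x ->
  f x + dot (grad f x) (y - x) <= f y.
Proof.
move=> cf df; rewrite addrC -lerBrDr; apply: (@dot_grad_le _ _ _ _ 0) => // t t01.
have := cf y x t t01; rewrite -!EFinM -EFinD lee_fin mulr0 addr0.
have -> : x + t *: (y - x) = t *: y + (1 - t) *: x.
  by rewrite scalerBr scalerBl scale1r addrCA addrA.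
lra.
Qed.

(** Tested along [w = grad f x - v] and along [- w], the subgradient inequality gives [dot w w = 0].
    This recognises a gradient without computing it. *)
Lemma subgradient_grad f x v : differentiable f x ->
  (forall y, f x + dot v (y - x) <= f y) -> grad f x = v.
Proof.
move=> df sub; apply/eqP; rewrite -subr_eq0; apply/eqP/dot_eq0.
set w := _ - v.
have : dot v w <= dot (grad f x) w.
  apply: (@dot_grad_ge _ _ _ _ 0) => // t _.
  by have := sub (x + t *: w); rewrite addrAC subrr add0r dotZr; lra.
have : dot v (- w) <= dot (grad f x) (- w).
  apply: (@dot_grad_ge _ _ _ _ 0) => // t _.
  by have := sub (x + t *: - w); rewrite addrAC subrr add0r dotZr; lra.
by rewrite {5 6}/w !dotE; have := dot_ge0 w; lra.
Qed.

(** Expanding the square of [x - c *: y] takes the place of the Cauchy-Schwarz inequality. *)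
Lemma dot_le_of_sqnorm_le (c : R) x y : 0 < c ->
  dot x x <= c ^+ 2 * dot y y -> dot x y <= c * dot y y.
Proof.
move=> c0 xy; have := dot_ge0 (x - c *: y); rewrite !dotE (dotC y x) => sq.
by rewrite -(ler_pM2l c0); nra.
Qed.

Lemma descent_lemma f (L : R) x y : 0 < L -> ksmooth L f ->
  f y <= f x + dot (grad f x) (y - x) + L / 2 * dot (y - x) (y - x).
Proof.
move=> L0 [df gL]; pose v := y - x.
(* Up to a constant, [f] on the line minus its quadratic upper model. The Lipschitz gradient makes
   its derivative nonpositive on [[0, 1]], so the mean value theorem replaces integration. *)
pose k (t : R) := f (x + t *: v) - (t * dot (grad f x) v + t ^+ 2 * (L / 2 * dot v v)).
have kd (t : R) : is_derive t 1 k (dot (grad f (x + t *: v)) v -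
    (dot (grad f x) v + 2 * t * (L / 2 * dot v v))).
  have dl := is_derive_line (df (x + t *: v)).
  exact: (is_deriveB dl (is_derive_quad _ _ _)).
have [] := @MVT_segment _ k _ 0 1 ler01 (fun t _ => kd t).
  by apply: derivable_within_continuous => t _; exact: ex_derive.
move=> t; rewrite in_itv /= => /andP[t0 t1].
rewrite subr0 mulr1 /k scale1r scale0r !mul1r !mul0r !addr0 expr0n expr1n /=.
rewrite mul0r mul1r.
have -> : x + v = y by rewrite /v addrC subrK.
have := elipschitz_sqr (x + t *: v) x (ltW L0) gL.
set g := grad f _ - _.
have -> : x + t *: v - x = t *: v by rewrite addrAC subrr add0r.
have gE : grad f (x + t *: v) = g + grad f x by rewrite /g subrK.
rewrite gE dotDl.
rewrite dotZl dotZr => gl.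
suff : dot g v <= L * t * dot v v by lra.
(* The mean value point may be 0, where [dot_le_of_sqnorm_le] lacks a positive constant. *)
have [t0'|] := ltP 0 t; last first.
  move=> t0'; have t00 : t = 0 by apply/le_anti/andP.
  by rewrite /g t00 scale0r addr0 subrr dotC -(scale0r 0) dotZr mulr0 !mul0r.
have Lt : 0 < L * t by rewrite mulr_gt0.
apply: dot_le_of_sqnorm_le => //; apply: le_trans gl _.
by rewrite exprMn (expr2 t) -!mulrA.
Qed.

(** Baillon-Haddad, by adding [half] to itself with [x] and [y] exchanged. *)
Lemma grad_cocoercive f (L : R) x y : 0 < L -> econvex (EFin \o f) -> ksmooth L f ->
  dot (grad f x - grad f y) (grad f x - grad f y) <=
  L * dot (grad f x - grad f y) (x - y).
Proof.
move=> L0 cf [df gL].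
(* The affine minorant based at [a] and the quadratic majorant based at [b] are compared where their
   gap is smallest, at [b + L^-1 *: (grad f a - grad f b)]. *)
have half a b : dot (grad f a - grad f b) (grad f a - grad f b) / (2 * L) <=
    f b - f a - dot (grad f a) (b - a).
  have [g gE] : exists g, grad f a = g + grad f b.
    by exists (grad f a - grad f b); rewrite subrK.
  have := convex_grad_ge (b + L^-1 *: g) cf (df a).
  have := descent_lemma b (b + L^-1 *: g) L0 (conj df gL).
  have -> : b + L^-1 *: g - b = L^-1 *: g by rewrite addrAC subrr add0r.
  rewrite gE addrK !dotE.
  have -> : L / 2 * (L^-1 * (L^-1 * dot g g)) = L^-1 * dot g g / 2.
    by field; rewrite gt_eqF.
  have -> : dot g g / (2 * L) = L^-1 * dot g g / 2 by field; rewrite gt_eqF.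
  lra.
have := half x y; have := half y x.
move: (grad f x) (grad f y) => gx gy; rewrite !ler_pdivrMr ?mulr_gt0 // !dotE.
rewrite (dotC gy gx); lra.
Qed.

End GradientTheory.

(** * Lipschitz maps in squared form, on vectors and on pairs stored by [row_mx] *)

Definition sq_lipschitz {R : realType} {m n : nat} (F : 'rV[R]_m -> 'rV[R]_n) :=
  exists2 L : R, 0 <= L &
    forall x y, dot (F x - F y) (F x - F y) <= L * dot (x - y) (x - y).

Section SqLipschitz.
Context {R : realType} {l m n : nat}.

Lemma sq_lipschitz_add (F G : 'rV[R]_m -> 'rV[R]_n) :
  sq_lipschitz F -> sq_lipschitz G -> sq_lipschitz (fun x => F x + G x).
Proof.
move=> [L L0 FL] [K K0 GK]; exists (2 * (L + K)) => [|x y].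
  by rewrite mulr_ge0 // addr_ge0.
rewrite opprD addrACA; apply: le_trans (dotD_le _ _) _.
have := FL x y; have := GK x y; lra.
Qed.

Lemma sq_lipschitz_scale a (F : 'rV[R]_m -> 'rV[R]_n) :
  sq_lipschitz F -> sq_lipschitz (fun x => a *: F x).
Proof.
move=> [L L0 FL]; exists (a ^+ 2 * L) => [|x y]; first by rewrite mulr_ge0 ?sqr_ge0.
by rewrite -scalerBr dotZl dotZr mulrA -expr2 -mulrA ler_wpM2l ?sqr_ge0.
Qed.

Lemma sq_lipschitz_comp (F : 'rV[R]_m -> 'rV[R]_n) (G : 'rV[R]_l -> 'rV[R]_m) :
  sq_lipschitz F -> sq_lipschitz G -> sq_lipschitz (fun x => F (G x)).
Proof.
move=> [L L0 FL] [K K0 GK]; exists (L * K) => [|x y]; first by rewrite mulr_ge0.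
by apply: le_trans (FL _ _) _; rewrite -mulrA ler_wpM2l.
Qed.

Lemma dot_row_mx (a b : 'rV[R]_m) (a' b' : 'rV[R]_n) :
  dot (row_mx a a') (row_mx b b') = dot a b + dot a' b'.
Proof.
rewrite /dot big_split_ord /=.
by congr (_ + _); apply: eq_bigr => i _; rewrite !(row_mxEl, row_mxEr).
Qed.

Lemma dot_submx (x y : 'rV[R]_(m + n)) :
  dot x y = dot (lsubmx x) (lsubmx y) + dot (rsubmx x) (rsubmx y).
Proof. by rewrite -dot_row_mx !hsubmxK. Qed.

Lemma sq_lipschitz_lsubmx : sq_lipschitz (@lsubmx R 1 m n).
Proof.
exists 1 => // x y; rewrite -linearB mul1r [leRHS]dot_submx lerDl.
exact: dot_ge0.
Qed.

Lemma sq_lipschitz_rsubmx : sq_lipschitz (@rsubmx R 1 m n).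
Proof.
exists 1 => // x y; rewrite -linearB mul1r [leRHS]dot_submx lerDr.
exact: dot_ge0.
Qed.

Lemma sq_lipschitz_row_mx (F : 'rV[R]_l -> 'rV[R]_m) (G : 'rV[R]_l -> 'rV[R]_n) :
  sq_lipschitz F -> sq_lipschitz G -> sq_lipschitz (fun x => row_mx (F x) (G x)).
Proof.
move=> [L L0 FL] [K K0 GK]; exists (L + K) => [|x y]; first by rewrite addr_ge0.
by rewrite opp_row_mx add_row_mx dot_row_mx mulrDl lerD.
Qed.

(** For [a = F x - F y] and [b = x - y], cocoercivity and the nonnegative square of [b - c *: a]
    bound [c ^+ 2 * dot a a] by [dot b b]. *)
Lemma cocoercive_sq_lipschitz (F : 'rV[R]_m -> 'rV[R]_m) (c : R) : 0 < c ->
  (forall x y, c * dot (F x - F y) (F x - F y) <= dot (F x - F y) (x - y)) ->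
  sq_lipschitz F.
Proof.
move=> c0 Fc; exists (c ^- 2) => [|x y]; first by rewrite invr_ge0 exprn_ge0 ?ltW.
rewrite ler_pdivlMl ?exprn_gt0 //.
have := dot_ge0 (x - y - c *: (F x - F y)); have := Fc x y.
move: (F x - F y) (x - y) => a b; rewrite !dotE (dotC b a); nra.
Qed.

End SqLipschitz.

(* The iteration is a forward-backward step preconditioned by the matrix
   [[1/tau, 1], [1, 1/sigma]]; condition (ii) says that this matrix, with
   kappa/2 subtracted from its first entry, is still positive definite. *)
Section PrimalDual.
Context {R : realType} {d : nat}.
Variables (D G : 'rV[R]_d -> 'rV[R]_d) (beta kappa sigma tau : R).
Hypotheses (beta0 : 0 < beta) (kappa0 : 0 < kappa).
Hypotheses (sigma0 : 0 < sigma) (tau0 : 0 < tau).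
Hypothesis sigma_beta : sigma <= (sigma + 1) * beta.
Hypothesis tau_small : tau * (sigma + kappa / 2) < 1.
Hypothesis Dcoco : forall x y,
  beta * dot (D x - D y) (D x - D y) <= dot (D x - D y) (x - y).
Hypothesis Gcoco : forall x y,
  dot (G x - G y) (G x - G y) <= kappa * dot (G x - G y) (x - y).

(** For [D = grad psi] and g = (sigma + 1) psi^* - sigma / 2 |.|^2 convex, this is the proximal map
    of sigma g^* at [u + sigma *: v], by Moreau's identity: the value of [D] is the proximal point
    of g / sigma at [sigma^-1 *: (u + sigma *: v)]. *)
Definition dual_step (v u : 'rV[R]_d) : 'rV[R]_d :=
  u + sigma *: v - sigma *: D ((sigma + 1)^-1 *: (u + sigma *: v)).

Definition primal_step (v u : 'rV[R]_d) : 'rV[R]_d :=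
  v - tau *: (G v + (2 *: dual_step v u - u)).

Definition saddle (v u : 'rV[R]_d) :=
  v = D ((sigma + 1)^-1 *: (u + sigma *: v)) /\ G v = - u.

Let step (z : 'rV[R]_(d + d)) :=
  row_mx (primal_step (lsubmx z) (rsubmx z)) (dual_step (lsubmx z) (rsubmx z)).

Let energy (a b : 'rV[R]_d) :=
  tau^-1 * dot a a + 2 * dot a b + sigma^-1 * dot b b.

Lemma step_fix v u : step (row_mx v u) = row_mx v u <-> saddle v u.
Proof.
rewrite /step row_mxKl row_mxKr /saddle; split.
  move=> /eq_row_mx[pv du].
  have w : v = D ((sigma + 1)^-1 *: (u + sigma *: v)).
    move: du => /eqP; rewrite /dual_step -addrA addrC -subr_eq0 addrK -scalerBr.
    by rewrite scaler_eq0 gt_eqF //= subr_eq0 => /eqP.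
  split=> //; move: pv => /eqP; rewrite /primal_step du.
  rewrite -subr_eq0 addrAC subrr add0r oppr_eq0 scaler_eq0 gt_eqF //=.
  by rewrite scaler_nat mulr2n addrK addr_eq0 => /eqP.
move=> [w g]; rewrite /primal_step /dual_step -w addrK g.
by rewrite scaler_nat mulr2n addrK addNr scaler0 subr0.
Qed.

(** Polarization: the energy changes by minus the energy of the step plus twice the pairing of the
    new point with the preconditioned step. By the equation for [e], that pairing is minus the sum
    of [dot e (a + da)] and the product assumed nonnegative. *)
Lemma energyD a b da db e : e = - (tau^-1 *: da + b + 2 *: db) ->
  0 <= dot (b + db) (a - sigma^-1 *: db) ->
  0 <= dot e (a + da) + kappa / 4 * dot da da ->
  energy (a + da) (b + db) <=
    energy a b - (energy da db - kappa / 2 * dot da da).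
Proof.
move=> ->; rewrite /energy !dotE.
rewrite (dotC da a) (dotC b a) (dotC db a) (dotC b da) (dotC db da) (dotC db b).
lra.
Qed.

Lemma energy_decr v u pv pu : saddle pv pu ->
  energy (primal_step v u - pv) (dual_step v u - pu) <=
  energy (v - pv) (u - pu) - (energy (primal_step v u - v) (dual_step v u - u)
    - kappa / 2 * dot (primal_step v u - v) (primal_step v u - v)).
Proof.
move=> [wp gp].
have E x y z : x - z = (y - z) + (x - y) :> 'rV[R]_d.
  by rewrite addrCA addrAC subrr add0r addrC.
rewrite (E (primal_step v u) v pv) (E (dual_step v u) u pu).
have defw : D ((sigma + 1)^-1 *: (u + sigma *: v)) - pv =
    v - pv - sigma^-1 *: (dual_step v u - u).
  by apply/rowP => i; rewrite /dual_step !mxE; field; rewrite gt_eqF.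
apply: (@energyD _ _ _ _ (G v - G pv)).
- rewrite gp; apply/rowP => i; rewrite /primal_step !mxE.
  by field; rewrite gt_eqF.
(* Here the product is [dot dp om - sigma * dot om om], and cocoercivity gives [dot dp om >= (sigma
   + 1) * beta * dot om om]. *)
- rewrite -defw; have := Dcoco ((sigma + 1)^-1 *: (u + sigma *: v))
    ((sigma + 1)^-1 *: (pu + sigma *: pv)).
  rewrite -wp -scalerBr dotZr; set om := D _ - pv.
  have -> : u - pu + (dual_step v u - u) =
      u + sigma *: v - (pu + sigma *: pv) - sigma *: om.
    by apply/rowP => i; rewrite /om /dual_step !mxE; ring.
  clearbody om; move: (u + sigma *: v - _) => dp.
  rewrite dotDl dotNl dotZl (dotC dp om) subr_ge0 ler_pdivlMl ?addr_gt0 // => h.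
  apply: le_trans h; rewrite mulrA ler_wpM2r ?dot_ge0 //.
(* The square of [e + (kappa / 2) *: da] pays for the gradient being taken at the old point and
   paired with the new one. *)
- have := dot_ge0 (G v - G pv + (kappa / 2) *: (primal_step v u - v)).
  have := Gcoco v pv.
  move: (G v - G pv) (v - pv) (primal_step v u - v) => e a da.
  rewrite !dotE (dotC da e) => h1 h2.
  by rewrite -(pmulr_rge0 _ kappa0); lra.
Qed.

(** Condition (ii) leaves room for [s] strictly between [sigma] and [tau^-1 - kappa / 2]. The form
    with coefficients [s], [2], [s^-1] is [s] times a square, and what remains of each diagonal
    coefficient is positive. *)
Lemma energy_coercive : exists2 c, 0 < c & forall a b,
  c * (dot a a + dot b b) <= energy a b - kappa / 2 * dot a a.
Proof.
have sa : sigma < tau^-1 - kappa / 2.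
  by rewrite ltrBrDr -(ltr_pM2l tau0) divff ?gt_eqF.
pose s := (sigma + (tau^-1 - kappa / 2)) / 2.
have [s1 s2] : sigma < s /\ s < tau^-1 - kappa / 2.
  by rewrite /s; move: (tau^-1 - _) sa => t sa; lra.
have s0 := lt_trans sigma0 s1.
exists (Num.min (tau^-1 - kappa / 2 - s) (sigma^-1 - s^-1)).
  by rewrite lt_min !subr_gt0 s2 ltf_pV2.
move=> a b; set c := Num.min _ _.
have ca : c <= tau^-1 - kappa / 2 - s by rewrite /c ge_min lexx.
have cb : c <= sigma^-1 - s^-1 by rewrite /c ge_min lexx orbT.
have sq : 0 <= s * dot a a + 2 * dot a b + s^-1 * dot b b.
  have -> : s * dot a a + 2 * dot a b + s^-1 * dot b b =
      s * dot (a + s^-1 *: b) (a + s^-1 *: b).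
    by rewrite !dotE (dotC b a); field; rewrite gt_eqF.
  by rewrite mulr_ge0 ?dot_ge0 ?ltW.
rewrite /energy.
have := ler_wpM2r (dot_ge0 a) ca; have := ler_wpM2r (dot_ge0 b) cb; lra.
Qed.

Lemma primal_dual_cvg (v u : nat -> 'rV[R]_d) v0 u0 :
  (forall k, u k.+1 = dual_step (v k) (u k)) ->
  (forall k, v k.+1 = primal_step (v k) (u k)) ->
  saddle v0 u0 ->
  exists vc uc, [/\ v @ \oo --> vc, u @ \oo --> uc & saddle vc uc].
Proof.
move=> uS vS sad; have [c c0 cE] := energy_coercive.
pose z k := row_mx (v k) (u k).
pose E x := energy (lsubmx x) (rsubmx x).
have Dlip := cocoercive_sq_lipschitz beta0 Dcoco.
have [L L0 stepL] : sq_lipschitz step.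
  have Glip : sq_lipschitz G.
    apply: (@cocoercive_sq_lipschitz _ _ _ kappa^-1) => [|x y].
      by rewrite invr_gt0.
    by rewrite ler_pdivrMl.
  have vlip := @sq_lipschitz_lsubmx R d d.
  have ulip := @sq_lipschitz_rsubmx R d d.
  have dlip : sq_lipschitz (fun z => dual_step (lsubmx z) (rsubmx z)).
    rewrite /dual_step; under eq_fun do rewrite -scaleNr.
    have plip := sq_lipschitz_add ulip (sq_lipschitz_scale sigma vlip).
    apply: (sq_lipschitz_add plip); apply: sq_lipschitz_scale.
    by apply: (sq_lipschitz_comp Dlip); apply: sq_lipschitz_scale.
  apply: sq_lipschitz_row_mx => //; rewrite /primal_step.
  under eq_fun do rewrite -scaleNr -[- rsubmx _]scaleN1r.
  apply: (sq_lipschitz_add vlip); apply: sq_lipschitz_scale.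
  apply: sq_lipschitz_add; first exact: (sq_lipschitz_comp Glip vlip).
  by apply: sq_lipschitz_add; apply: sq_lipschitz_scale.
have zS k : z k.+1 = step (z k).
  by rewrite /z uS vS /step row_mxKl row_mxKr.
(* The upper constant comes from [2 * dot a b <= dot a a + dot b b]. *)
have [] := @fejer_fixpoint_cvg _ _ z step L c (tau^-1 + sigma^-1 + 1) E
  (row_mx v0 u0) zS stepL c0.
- move=> x; rewrite dot_submx; apply: le_trans (cE _ _) _.
  by rewrite lerBlDr lerDl mulr_ge0 ?dot_ge0 // divr_ge0 ?ltW.
- move=> x; rewrite dot_submx /E /energy.
  move: (lsubmx x) (rsubmx x) => a b.
  have := dot_ge0 (a - b); rewrite !dotE (dotC b a).
  have : 0 <= tau^-1 * dot b b by rewrite mulr_ge0 ?dot_ge0 ?invr_ge0 ?ltW.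
  have : 0 <= sigma^-1 * dot a a by rewrite mulr_ge0 ?dot_ge0 ?invr_ge0 ?ltW.
  lra.
- move=> p x; rewrite -[p]hsubmxK => /step_fix sp.
  rewrite /E !linearB /= !row_mxKl !row_mxKr.
  apply: le_trans (energy_decr _ _ sp) _; rewrite lerD2l lerN2.
  by apply: le_trans _ (cE _ _); rewrite dot_submx !linearB /= !row_mxKl !row_mxKr.
- exact/step_fix.
move=> p; rewrite -[p]hsubmxK => /step_fix sp zp.
exists (lsubmx p), (rsubmx p); split=> //; apply: cvg_dot_sub;
  apply: (squeeze_cvgr _ (cvg_cst 0) zp); apply: nearW => k;
  rewrite dot_ge0 opp_row_mx add_row_mx dot_row_mx /=.
  by rewrite lerDl dot_ge0.
by rewrite lerDr dot_ge0.
Qed.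

End PrimalDual.

(** * Fenchel conjugates and duality *)

Section ConjugateTheory.
Context {R : realType} {d : nat}.
Implicit Types (f : 'rV[R]_d -> R) (g : 'rV[R]_d -> \bar R) (p q v w x y z : 'rV[R]_d).

Lemma conjugate_ge g p w r : g p = r%:E -> ((dot p w - r)%:E <= conjugate g w)%E.
Proof. by move=> gp; apply: ereal_sup_ubound; exists p => //; rewrite gp EFinB. Qed.

(** The subgradient inequality at [p] says that [p] attains the supremum: equality in
    Fenchel-Young. *)
Lemma conjugate_subgradient g p w r : g p = r%:E ->
  (forall q, ((r + dot w (q - p))%:E <= g q)%E) ->
  conjugate g w = (dot p w - r)%:E.
Proof.
move=> gp sub; apply/le_anti; rewrite conjugate_ge // andbT.
apply: ge_ereal_sup => _ [q _ <-]; have := sub q.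
case: (g q) => [s| |] //=; rewrite ?leNye // -EFinB !lee_fin dotDr dotNr.
rewrite (dotC w q) (dotC w p); lra.
Qed.

Lemma conjugate_segment_le g x y a b (t : R) : (forall z, g z != -oo%E) -> 0 < t < 1 ->
  conjugate g x = a%:E -> conjugate g y = b%:E ->
  (conjugate g (t *: x + (1 - t) *: y) <= (t * a + (1 - t) * b)%:E)%E.
Proof.
move=> gNy /andP[t0 t1] ga gb; apply: ge_ereal_sup => _ [q _ <-].
case gq : (g q) => [s| |]; last 2 first.
- by rewrite leNye.
- by have := gNy q; rewrite gq.
have := conjugate_ge x gq; have := conjugate_ge y gq.
rewrite ga gb -EFinB !lee_fin !dotE => hy hx.
have := ler_wpM2l (ltW t0) hx; have t1' : 0 <= 1 - t by lra.
have := ler_wpM2l t1' hy; lra.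
Qed.

(** For convex [f] this is strong convexity of the conjugate, with modulus [L^-1], seen from
    [grad f p]. The test point [q] maximizes the lower bound on [dot q y - f q] given by
    [descent_lemma]. *)
Lemma conjugate_grad_ge f (L : R) p y : 0 < L -> ksmooth L f ->
  ((dot p y - f p + (2 * L)^-1 * dot (y - grad f p) (y - grad f p))%:E <=
   conjugate (EFin \o f) y)%E.
Proof.
move=> L0 sf; pose q := p + L^-1 *: (y - grad f p).
apply: le_trans (@conjugate_ge _ q y (f q) erefl); rewrite lee_fin.
have := descent_lemma p q L0 sf.
have -> : q - p = L^-1 *: (y - grad f p) by rewrite /q addrAC subrr add0r.
rewrite {2}/q; move: (f q) (grad f p) => fq w.
rewrite !dotE (dotC w y).
have -> : (2 * L)^-1 = L^-1 / 2 by rewrite invfM mulrC.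
have -> : L / 2 * (L^-1 * (L^-1 * (dot y y - dot y w) - L^-1 * (dot y w - dot w w)))
  = L^-1 / 2 * (dot y y - dot y w - (dot y w - dot w w)).
  by field; rewrite gt_eqF.
lra.
Qed.

(** Primal: adding the two subgradient inequalities cancels the linear terms. Dual: testing both
    suprema at [v] bounds every value below by [- (f v + r)], attained at [u]. *)
Lemma fenchel_duality f g v u r : g v = r%:E ->
  (forall y, ((r + dot u (y - v))%:E <= g y)%E) ->
  (forall y, f v + dot (- u) (y - v) <= f y) ->
  minimizer (fun w => (f w)%:E + g w)%E v /\
  minimizer (fun z => conjugate (EFin \o f) (- z) + conjugate g z)%E u.
Proof.
move=> gv gsub fsub; split => y /=.
  apply: (@le_trans _ _ ((f y)%:E + (r + dot u (y - v))%:E)%E); last exact: leeD2l.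
  rewrite gv -!EFinD lee_fin; have := fsub y; rewrite dotNl; lra.
rewrite (conjugate_subgradient gv gsub).
rewrite (@conjugate_subgradient (EFin \o f) v (- u) (f v)) //.
apply: le_trans _ (leeD (@conjugate_ge _ v (- y) (f v) erefl) (conjugate_ge y gv)).
rewrite -!EFinD lee_fin !dotNr; lra.
Qed.

Lemma differentiable_sqnorm x : differentiable (fun w => dot w w : R) x.
Proof.
have -> : (fun w => dot w w : R) = \sum_(i < d) (fun w : 'rV[R]_d => w 0 i * w 0 i).
  by apply/funext => w; rewrite fct_sumE.
apply: differentiable_sum => i.
by apply: differentiableM; exact: differentiable_coord.
Qed.

(** [grad f x + x] is a subgradient of the sum, since the half square exceeds its linearization by
    half of [dot (y - x) (y - x)]; [subgradient_grad] concludes. *)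
Lemma grad_add_half_sqnorm f x : econvex (EFin \o f) ->
  (forall y, differentiable f y) ->
  grad (fun w => f w + 2^-1 * dot w w) x = grad f x + x.
Proof.
move=> cf df; apply: subgradient_grad => [|y].
  apply: (@differentiableD _ _ _ f (fun w => 2^-1 * dot w w)) => //.
  apply: (@differentiableZ _ _ _ (fun w => dot w w)); exact: differentiable_sqnorm.
have := convex_grad_ge y cf (df x); have := dot_ge0 (y - x).
move: (grad f x) => w; rewrite !dotE (dotC y x); lra.
Qed.

End ConjugateTheory.

(** * Orthogonal projections and Pythagoras *)

Section OrthogonalProjection.
Context {R : realType} {d : nat}.
Implicit Types (M : {vspace 'rV[R]_d}) (v : 'rV[R]_d).

(** The difference of the two sides lies in [ocompl M] and is orthogonal to itself. *)
Lemma oproj_ocompl M v : oproj (ocompl M) v = v - oproj M v.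
Proof.
have rM : v - oproj M v \in ocompl M.
  apply/mem_orthovP => w wM; exact: oproj_orth.
apply/esym/eqP; rewrite -subr_eq0; apply/eqP/dot_eq0.
have rsM : v - oproj M v - oproj (ocompl M) v \in ocompl M.
  by rewrite rpredB // oproj_in.
rewrite {1}addrAC dotDl dotNl (oproj_orth v rsM) sub0r dotC.
by move/mem_orthovP: rsM => ->; rewrite ?oproj_in ?oppr0.
Qed.

Lemma sqnorm_oproj M v :
  enorm (oproj M v) ^+ 2 + enorm (oproj (ocompl M) v) ^+ 2 = dot v v.
Proof.
rewrite !enorm_sqr oproj_ocompl.
have := oproj_orth v (oproj_in M v); move: (oproj M v) => p.
rewrite !dotE (dotC p v); lra.
Qed.

End OrthogonalProjection.

(** * Optimality conditions for the regularized conjugate *)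

Section RegularizedConjugate.
Context {R : realType} {d : nat}.
Variables (psi : 'rV[R]_d -> R) (sigma : R).
Hypotheses (psi_convex : econvex (EFin \o psi)) (sigma0 : 0 < sigma).

(* For [sigma <= beta / (1 - beta)] this is convex, since the conjugate of a
   function with [beta^-1]-Lipschitz gradient is [beta]-strongly convex. *)
Definition reg_conjugate (w : 'rV[R]_d) : \bar R :=
  ((sigma + 1)%:E * conjugate (EFin \o psi) w - (sigma / 2 * dot w w)%:E)%E.

Lemma reg_conjugate_fin w (r : R) : conjugate (EFin \o psi) w = r%:E ->
  reg_conjugate w = ((sigma + 1) * r - sigma / 2 * dot w w)%:E.
Proof. by rewrite /reg_conjugate => ->; rewrite -EFinM -EFinB. Qed.

Lemma conjugate_grad p : differentiable psi p ->
  conjugate (EFin \o psi) (grad psi p) = (dot p (grad psi p) - psi p)%:E.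
Proof.
move=> dp; apply: conjugate_subgradient => // q.
by rewrite lee_fin; apply: convex_grad_ge.
Qed.

(** Let [p] be the argument of [grad psi] and [r] the conjugate of [psi] at [v]. First-order
    optimality on the segment from [v] to [grad psi p] gives [r <= dot p v - psi p], the reverse of
    Fenchel-Young, so [v] is a subgradient of [psi] at [p]. *)
Lemma minimizer_fixpoint (h : 'rV[R]_d -> R) v :
  (forall x, differentiable psi x) -> differentiable h v ->
  minimizer (fun w => (h w)%:E + reg_conjugate w)%E v ->
  v = grad psi ((sigma + 1)^-1 *: (- grad h v + sigma *: v)).
Proof.
move=> dpsi dh vmin.
have [p pE] : exists p, p = (sigma + 1)^-1 *: (- grad h v + sigma *: v) by eexists.
have [y yE] : exists y, y = grad psi p by eexists.
have s1 : 0 < sigma + 1 by rewrite addr_gt0.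
have defp : grad h v = sigma *: v - (sigma + 1) *: p.
  move: (grad h v) pE => gv ->.
  by rewrite scalerA divff ?gt_eqF // scale1r opprD opprK addrCA subrr addr0.
rewrite -pE; have psy := conjugate_grad (dpsi p); rewrite -yE in psy.
(* The finite value at [y] excludes [+oo] at the minimizer; the test point 0 excludes [-oo]. *)
have [r psv] : exists r : R, conjugate (EFin \o psi) v = r%:E.
  have := vmin y; rewrite (reg_conjugate_fin psy) /reg_conjugate.
  have := @conjugate_ge _ _ (EFin \o psi) 0 v (psi 0) erefl.
  case: (conjugate _ v) => [r _ _| | ]; [by exists r| |by []].
  by rewrite gt0_muley ?lte_fin.
have rle : r <= dot p v - psi p.
  (* The slope and the quadratic coefficient come from convexity of the conjugate on the segment and
     from expanding the subtracted square. *)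
  have := @dot_grad_ge _ _ h v (y - v)
    ((sigma + 1) * (r - (dot p y - psi p)) + sigma * dot v (y - v))
    (sigma / 2 * dot (y - v) (y - v)) dh.
  rewrite defp => ineq.
  have {ineq} : (sigma + 1) * (r - (dot p y - psi p)) + sigma * dot v (y - v) <=
       dot (sigma *: v - (sigma + 1) *: p) (y - v).
    apply: ineq => t t01; have := vmin (v + t *: (y - v)).
    have seg : v + t *: (y - v) = t *: y + (1 - t) *: v.
      by rewrite scalerBr scalerBl scale1r addrCA addrA.
    have : (conjugate (EFin \o psi) (v + t *: (y - v)) <=
            (t * (dot p y - psi p) + (1 - t) * r)%:E)%E.
      by rewrite seg; apply: conjugate_segment_le.
    rewrite (reg_conjugate_fin psv) /reg_conjugate.
    have := @conjugate_ge _ _ (EFin \o psi) 0 (v + t *: (y - v)) (psi 0) erefl.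
    case: (conjugate _ (v + _)) => [s _|_|//]; last by rewrite leye_eq.
    rewrite -EFinM -EFinB -!EFinD !lee_fin => sle.
    have {sle} := ler_wpM2l (ltW s1) sle.
    move: (y - v) (h _) => dl hs; rewrite !dotE (dotC dl v); lra.
  by move=> ineq; rewrite -(ler_pM2l s1); move: ineq; rewrite !dotE; lra.
apply/esym/subgradient_grad => // q.
have := @conjugate_ge _ _ (EFin \o psi) q v (psi q) erefl.
rewrite psv lee_fin dotDr dotNr (dotC v q) (dotC v p); lra.
Qed.

(** [u] is a subgradient of [reg_conjugate] at [v]: [conjugate_grad_ge] gains
    [(sigma + 1) * beta / 2] times the squared distance, which covers the [sigma / 2] lost to the
    subtracted square. Then [fenchel_duality] applies. *)
Lemma saddle_minimizer (h : 'rV[R]_d -> R) (beta : R) v u : 0 < beta ->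
  sigma <= (sigma + 1) * beta ->
  ksmooth beta^-1 psi -> econvex (EFin \o h) -> differentiable h v ->
  saddle (grad psi) (grad h) sigma v u ->
  minimizer (fun w => (h w)%:E + reg_conjugate w)%E v /\
  minimizer (fun z => conjugate (EFin \o h) (- z) + conjugate reg_conjugate z)%E u.
Proof.
move=> beta0 sbeta psi_smooth h_convex dh [vp hu].
have s1 : 0 < sigma + 1 by rewrite addr_gt0.
pose p := (sigma + 1)^-1 *: (u + sigma *: v).
have defu : u = (sigma + 1) *: p - sigma *: v.
  by rewrite /p scalerA divff ?gt_eqF // scale1r addrK.
have psv : conjugate (EFin \o psi) v = (dot p v - psi p)%:E.
  by rewrite {1 2}vp; apply: conjugate_grad; case: psi_smooth.
apply: (fenchel_duality (reg_conjugate_fin psv)) => y; last first.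
  by rewrite -hu; exact: convex_grad_ge.
have beta1 : 0 < beta^-1 by rewrite invr_gt0.
have := conjugate_grad_ge p y beta1 psi_smooth; rewrite -vp /reg_conjugate.
case: (conjugate _ y) => [s|_|//]; last by rewrite gt0_muley ?lte_fin ?leey.
rewrite -EFinM -EFinB !lee_fin => sge.
have {sge} := ler_wpM2l (ltW s1) sge.
have -> : (2 * beta^-1)^-1 = beta / 2 by rewrite invfM invrK mulrC.
have := ler_wpM2r (dot_ge0 (y - v)) sbeta.
rewrite defu !dotE (dotC y v); lra.
Qed.

End RegularizedConjugate.

(** * Reduction of the stated iteration and problems to the abstract scheme *)

Theorem proposition1 (R : realType) (d : nat)
  (beta : R) (hbeta : 0 < beta < 1)
  (psi : 'rV[R]_d -> R) (hpsi : Gamma0 (EFin \o psi))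
  (hpsi_diff : forall x, differentiable psi x)
  (D : 'rV[R]_d -> 'rV[R]_d) (hD : forall x, D x = grad psi x)
  (hD_lip : elipschitz beta^-1 D)
  (phi : 'rV[R]_d -> \bar R)
  (hphi : forall x,
    phi x = (conjugate (EFin \o psi) x - (2^-1 * enorm x ^+ 2)%:E)%E)
  (M : {vspace 'rV[R]_d}) (mu : R) (hmu : 0 < mu)
  (Phi : 'rV[R]_d -> R) (hPhi : Gamma0 (EFin \o Phi))
  (hPhi_smooth : smooth Phi)
  (h : 'rV[R]_d -> R)
  (hh : forall v, h v = mu * Phi v - 2^-1 * enorm (oproj M v) ^+ 2)
  (hh_Gamma0 : Gamma0 (EFin \o h))
  (kappa : R) (hkappa : 0 < kappa) (hh_smooth : ksmooth kappa h)
  (sigma tau : R) (hsigma : 0 < sigma) (htau : 0 < tau)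
  (hi : sigma <= beta / (1 - beta))
  (hii : tau * (sigma + kappa / 2) < 1)
  (v u vt ut : nat -> 'rV[R]_d)
  (hut : forall k, ut k.+1 = u k + sigma *: v k)
  (hu : forall k,
    u k.+1 = ut k.+1 - sigma *: D ((sigma + 1)^-1 *: ut k.+1))
  (hvt : forall k, vt k.+1 = tau *:
    grad (fun w => mu * Phi w + 2^-1 * enorm (oproj (ocompl M) w) ^+ 2) (v k))
  (hv : forall k, v k.+1 =
    (1 + tau) *: v k - vt k.+1 - tau *: (2 *: u k.+1 - u k)) :
  let primal (w : 'rV[R]_d) : \bar R :=
    ((mu * Phi w)%:E + (sigma + 1)%:E * phi w
     + (2^-1 * enorm (oproj (ocompl M) w) ^+ 2)%:E)%E in
  let dual (z : 'rV[R]_d) : \bar R :=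
    (conjugate (EFin \o h) (- z)
     + conjugate (fun w => (sigma + 1)%:E * phi w
                           + (2^-1 * enorm w ^+ 2)%:E) z)%E in
  (exists w, minimizer primal w) -> (exists z, minimizer dual z) ->
  exists vc uc : 'rV[R]_d,
    [/\ v @ \oo --> vc, u @ \oo --> uc, minimizer primal vc
      & minimizer dual uc].
Proof.
move=> primal dual [w0 w0min] _.
have /andP[beta0 beta1] := hbeta.
have psi_convex : econvex (EFin \o psi) by case: hpsi.
have h_convex : econvex (EFin \o h) by case: hh_Gamma0.
have [dh _] := hh_smooth.
have DE : D = grad psi by apply/funext.
have psi_smooth : ksmooth beta^-1 psi by split=> //; rewrite -DE.
have sbeta : sigma <= (sigma + 1) * beta.
  by move: hi; rewrite ler_pdivlMr ?subr_gt0 //; lra.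
(* On finite values, the added half square cancels one of the [sigma + 1] half squares subtracted
   through [phi], leaving [sigma / 2]. *)
have gE w : ((sigma + 1)%:E * phi w + (2^-1 * enorm w ^+ 2)%:E)%E =
    reg_conjugate psi sigma w.
  rewrite hphi /reg_conjugate enorm_sqr.
  case: (conjugate _ w) => [r| |].
  - by rewrite -EFinB -!EFinM -EFinD -EFinB; congr EFin; lra.
  - by rewrite addye // gt0_muley ?lte_fin ?addr_gt0 // !addye.
  - by rewrite addNye // gt0_muleNy ?lte_fin ?addr_gt0 // !addNye.
have smoothE w : mu * Phi w + 2^-1 * enorm (oproj (ocompl M) w) ^+ 2 =
    h w + 2^-1 * dot w w.
  by rewrite hh -(sqnorm_oproj M w); lra.
have primalE : primal = (fun w => (h w)%:E + reg_conjugate psi sigma w)%E.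
  apply/funext => w; rewrite /primal addeAC -EFinD smoothE EFinD -gE enorm_sqr.
  by rewrite -addeA [((_ * dot w w)%:E + _)%E]addeC.
have dualE : dual = (fun z => conjugate (EFin \o h) (- z) +
    conjugate (reg_conjugate psi sigma) z)%E.
  by apply/funext => z; rewrite /dual; congr (_ + conjugate _ _)%E; apply/funext.
(* The summand [v k] of this gradient cancels the [tau] in the factor [1 + tau] of the update, which
   becomes [primal_step]. *)
have vtE k : vt k.+1 = tau *: (grad h (v k) + v k).
  by rewrite hvt; under eq_fun do rewrite smoothE; rewrite grad_add_half_sqnorm.
have Dcoco x y : beta * dot (D x - D y) (D x - D y) <= dot (D x - D y) (x - y).
  have bi : 0 < beta^-1 by rewrite invr_gt0.
  by rewrite -ler_pdivlMl // DE; exact: grad_cocoercive bi psi_convex psi_smooth.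
have Gcoco x y := grad_cocoercive x y hkappa h_convex hh_smooth.
have uS k : u k.+1 = dual_step D sigma (v k) (u k) by rewrite hu hut.
have vS k : v k.+1 = primal_step D (grad h) sigma tau (v k) (u k).
  rewrite hv vtE /primal_step -uS; apply/rowP => i.
  by move: (grad h _) => g; rewrite !mxE; ring.
have sad : saddle D (grad h) sigma w0 (- grad h w0).
  split; last by rewrite opprK.
  by rewrite DE; apply: minimizer_fixpoint; rewrite -?primalE.
have [vc [uc [vcvg ucvg sadc]]] := primal_dual_cvg beta0 hkappa hsigma htau sbeta
  hii Dcoco Gcoco uS vS sad.
exists vc, uc; rewrite DE in sadc.
have [] := saddle_minimizer psi_convex hsigma beta0 sbeta psi_smooth h_convex
  (dh vc) sadc.
by rewrite primalE dualE; split.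
Qed.
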